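(* Let $q=2p$ be even with $p\ge2$, and let $\lambda=2\cos(\pi/q)$. For every $G_q$-irrational $x$ (in $[-\lambda/2,\lambda/2)$) there are infinitely many $n\in\mathbb{N}$ for which $$\Theta_n(x)\le\mathcal{H}_q=\frac12.$$ The constant $1/2$ is best possible, i.e. it cannot be replaced by any smaller constant in this statement.
   Context: Rosen continued fractions. For $x\in[-\lambda/2,\lambda/2)$, $x\neq 0$, let $\varepsilon(x)\in\{\pm1\}$ be the sign of $x$ and $r(x)=\left\lfloor \frac{1}{\lambda|x|}+\frac12\right\rfloor$. Define $f_q:[-\lambda/2,\lambda/2)\to[-\lambda/2,\lambda/2)$ by $f_q(x)=\frac{1}{|x|}-\lambda r(x)$ for $x\ne0$ and $f_q(0)=0$. Put $\varepsilon_n=\varepsilon(f_q^{n-1}(x))$ and $r_n=r(f_q^{n-1}(x))$ for $n\ge1$ as long as $f_q^{n-1}(x)\neq0$. This gives the Rosen expansion $$x=[\varepsilon_1:r_1,\varepsilon_2:r_2,\ldots]:=\cfrac{\varepsilon_1}{r_1\lambda+\cfrac{\varepsilon_2}{r_2\lambda+\cdots}}.$$ The number $x$ is $G_q$-rational if its Rosen expansion is finite (i.e. $f_q^m(x)=0$ for some $m\ge 0$), and $G_q$-irrational otherwise. Convergents: $R_n/S_n=[\varepsilon_1:r_1,\ldots,\varepsilon_n:r_n]$, with $R_{-1}=1$, $R_0=0$, $S_{-1}=0$, $S_0=1$, $R_n=r_n\lambda R_{n-1}+\varepsilon_nR_{n-2}$, $S_n=r_n\lambda S_{n-1}+\varepsilon_nS_{n-2}$.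 The approximation coefficients are $\Theta_n(x)=S_n^2\left|x-\frac{R_n}{S_n}\right|$, $n\ge0$. *)

(* Defs.v *)
From mathcomp Require Import all_boot all_order all_algebra.
From mathcomp Require Import all_classical all_reals all_analysis.

Set Implicit Arguments.
Unset Strict Implicit.
Unset Printing Implicit Defensive.

Import Order.TTheory GRing.Theory Num.Theory.

Local Open Scope ring_scope.

Definition rosen_lambda {R : realType} (q : nat) : R := 2 * cos (pi / q%:R).

Definition rosen_interval {R : realType} (q : nat) (x : R) : Prop :=
  - (rosen_lambda q / 2) <= x < rosen_lambda q / 2.

Definition rosen_r {R : realType} (q : nat) (x : R) : int :=
  Num.floor (1 / (rosen_lambda q * `|x|) + 1 / 2).

(* Total on R; only its restriction to [rosen_interval q], which it maps to
   itself, is meaningful. *)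
Definition rosen_map {R : realType} (q : nat) (x : R) : R :=
  if x == 0 then 0 else 1 / `|x| - rosen_lambda q * (rosen_r q x)%:~R.

(* Digits are numbered from n = 1 and are meaningful as long as
   [iter n.-1 (rosen_map q) x] is nonzero. *)
Definition rosen_eps_digit {R : realType} (q : nat) (x : R) (n : nat) : R :=
  Num.sg (iter n.-1 (rosen_map q) x).

Definition rosen_r_digit {R : realType} (q : nat) (x : R) (n : nat) : int :=
  rosen_r q (iter n.-1 (rosen_map q) x).

Definition Gq_rational {R : realType} (q : nat) (x : R) : Prop :=
  exists m : nat, iter m (rosen_map q) x = 0.

Definition Gq_irrational {R : realType} (q : nat) (x : R) : Prop :=
  ~ Gq_rational q x.

(* The pair (u_(n-1), u_n), where u_(-1) = a, u_0 = b and
   u_n = r_n * lambda * u_(n-1) + eps_n * u_(n-2) for n >= 1. *)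
Fixpoint rosen_rec {R : realType} (q : nat) (x a b : R) (n : nat) : R * R :=
  if n is k.+1 then
    let u := rosen_rec q x a b k in
    (u.2, (rosen_r_digit q x n)%:~R * rosen_lambda q * u.2
          + rosen_eps_digit q x n * u.1)
  else (a, b).

Definition rosen_R {R : realType} (q : nat) (x : R) (n : nat) : R :=
  (rosen_rec q x 1 0 n).2.

Definition rosen_S {R : realType} (q : nat) (x : R) (n : nat) : R :=
  (rosen_rec q x 0 1 n).2.

Definition rosen_Theta {R : realType} (q : nat) (x : R) (n : nat) : R :=
  rosen_S q x n ^+ 2 * `|x - rosen_R q x n / rosen_S q x n|.

(* Main.v *)
Require Import Defs.
From mathcomp Require Import all_boot all_order all_algebra.
From mathcomp Require Import all_classical all_reals all_analysis.
From mathcomp Require Import zify ring lra.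

(** Write [t_n = f_q^n(x)], [v_n = S_(n-1)/S_n] and [l] for lambda.  Then
    [Theta_n = |t_n| / (1 + t_n v_n)] and [Theta_(n-1) = v_n / (1 + t_n v_n)].
    If [t_n > 0], these cannot both exceed 1/2, because [2 (t_n - 1)^2 >= 0].
    If [t_n < 0] for all large [n], then [|t_n| <= l - 1] for those [n]: above
    [l - 1] the digits are forced to follow the periodic orbit with digits
    [(-1 : 1)^(p-2), (-1 : 2)], from which [|t_n|] drifts away geometrically.
    Some later digit is at least 2, and there [|t_(n+1)| <= l - 1] and
    [v_n <= l - 1] (read off the natural extension domain) give
    [Theta_n <= 1/2].  The same periodic orbit, started at [x = -(l - 1)],
    satisfies [Theta_n >= 1/2 - o(1)], so 1/2 is optimal. *)

Set Implicit Arguments.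
Unset Strict Implicit.
Unset Printing Implicit Defensive.

Import Order.TTheory GRing.Theory Num.Theory.

Local Open Scope classical_set_scope.
Local Open Scope ring_scope.

(** * The branch [y -> 1 / (l - y)] and its two distinguished orbits *)

(** Inverse branch of [f_q] on negative points, up to sign: for [t < 0] with digit 1,
    [- t = hstep l (- f_q t)]; a digit [r] replaces [l] by [r * l]. *)
Definition hstep {R : fieldType} (l y : R) : R := (l - y)^-1.

(* With l = 2 cos a, a = pi / q: beta k = sin (k a) / sin ((k + 1) a) is the
   absolute value of a point of the orbit of -l/2, and
   alpha k = sin ((k + 1/2) a) / sin ((k + 3/2) a).  Below, m stands for p - 2. *)
Definition beta {R : fieldType} (l : R) (k : nat) : R := iter k (hstep l) 0.

Definition alpha {R : fieldType} (l : R) (k : nat) : R :=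
  iter k (hstep l) (l + 1)^-1.

Arguments beta : simpl never.
Arguments alpha : simpl never.

(** Since [sin x + sin (x + 2 a) = 2 cos a sin (x + a)], a step just advances both angles by [a]. *)
Lemma hstep_sin {R : realType} (x a : R) :
  0 < sin (x + a) -> 0 < sin (x + a + a) ->
  hstep (2 * cos a) (sin x / sin (x + a)) = sin (x + a) / sin (x + a + a).
Proof.
move=> h1 h2.
have e : 2 * cos a - sin x / sin (x + a) = sin (x + a + a) / sin (x + a).
  rewrite -{1}(addrK a x) sinB [in RHS]sinD; field.
  by rewrite gt_eqF.
by rewrite /hstep e invf_div.
Qed.

Lemma iter_hstep_sin {R : realType} (x a : R) (k : nat) :
  (forall i, (i <= k)%N -> 0 < sin (x + a * i.+1%:R)) ->
  iter k (hstep (2 * cos a)) (sin x / sin (x + a)) =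
    sin (x + a * k%:R) / sin (x + a * k.+1%:R).
Proof.
elim: k => [|k IH] h; first by rewrite /= mulr0 addr0 mulr1.
rewrite iterS IH; last by move=> i ik; apply: h; lia.
have e (i : nat) : x + a * i.+1%:R = x + a * i%:R + a.
  by rewrite -natr1; ring.
by rewrite !e hstep_sin // -!e; apply: h.
Qed.

(** An iterate [u] is below [l] exactly when the next one, [(l - u)^-1], is positive; hence
    positivity is asked one index further. *)
Lemma iter_hstep_sin_lt {R : realType} (x a : R) (k : nat) :
  (forall i, (i <= k.+1)%N -> 0 < sin (x + a * i.+1%:R)) ->
  iter k (hstep (2 * cos a)) (sin x / sin (x + a)) < 2 * cos a.
Proof.
move=> h; rewrite -subr_gt0 -invr_gt0.
have := iter_hstep_sin h; rewrite iterS /hstep => ->.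
by rewrite divr_gt0 ?h.
Qed.

Lemma iter_hstep_incr {R : realType} (l y : R) (n : nat) :
  y < hstep l y -> (forall k, (k <= n)%N -> iter k (hstep l) y < l) ->
  forall k, (k <= n)%N -> iter k (hstep l) y < iter k.+1 (hstep l) y.
Proof.
move=> y0 h; elim=> [//|k IH] kn.
have := IH (ltnW kn); have := h _ kn; have := h _ (ltnW kn).
rewrite [iter k.+2 _ _]iterS /hstep -/(hstep l).
set u := iter k _ _; set w := iter k.+1 _ _ => ul wl uw.
rewrite {1}/w iterS -/u /hstep ltf_pV2 ?posrE ?subr_gt0 //; lra.
Qed.

(** All that later arguments use about lambda. The first equation makes the orbit of [- l / 2] reach
    0 after [m + 1] digits 1; the second closes a cycle, as [alpha l 0 = 1 / (2 l - (l - 1))]. *)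
Definition hecke_orbits {R : realType} (m : nat) (l : R) : Prop :=
  [/\ 1 < l < 2, beta l m.+1 = l / 2, alpha l m = l - 1,
      forall k, (k <= m)%N -> beta l k < l
    & forall k, (k <= m)%N -> alpha l k < l].

(** Evenness of [q] enters here: [(m + 2) a = pi / 2] turns the final sine quotients into [cos a]
    and [cos (3 a / 2) / cos (a / 2) = 2 cos a - 1]. *)
Lemma hecke_orbits_lambda {R : realType} (m : nat) :
  hecke_orbits m (rosen_lambda (2 * m.+2) : R).
Proof.
rewrite /rosen_lambda; set a : R := pi / _.
have ea : a * m.+2%:R = pi / 2.
  by rewrite /a natrM; field; rewrite ?pnatr_eq0.
have pi0 : (0 : R) < pi := pi_gt0 R.
have a0 : 0 < a by rewrite /a divr_gt0 // ltr0n.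
have ale : a * 2 <= pi / 2 by rewrite -ea ler_wpM2l ?ler_nat // ltW.
(* The offset [c] will be 0 for [beta] and [a / 2] for [alpha]. *)
have sin_pos (c : R) (k i : nat) : 0 <= c <= a -> (i <= k)%N ->
    (k.+1 <= m.+2)%N -> 0 < sin (c + a * i.+1%:R).
  move=> /andP[c0 ca] ik km.
  have h1 : a * i.+1%:R <= pi / 2 by rewrite -ea ler_wpM2l ?ler_nat ?ltW //; lia.
  have h2 : 0 < a * i.+1%:R by rewrite mulr_gt0 // ltr0n.
  by apply: sin_gt0_pi; apply/andP; split; lra.
have zero : 0 = sin 0 / sin (0 + a) :> R by rewrite sin0 mul0r.
have sa : 0 < sin a by apply: sin_gt0_pi; apply/andP; split; lra.
have sh : 0 < sin (a / 2) by apply: sin_gt0_pi; apply/andP; split; lra.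
have sah : 0 < sin (a / 2 + a) by apply: sin_gt0_pi; apply/andP; split; lra.
have c2 : 0 <= cos (a * 2) by apply: cos_ge0_pihalf; apply/andP; split; lra.
have ca : 0 <= cos a by apply: cos_ge0_pihalf; apply/andP; split; lra.
(* [4 cos^2 a = 2 + 2 cos (2 a)], and [2 a <= pi / 2]. *)
have l2 : 2 <= (2 * cos a) ^+ 2.
  have := c2; rewrite mulr_natr cos_mulr2n; lra.
have lt2 : 2 * cos a < 2.
  have := sin2cos2 a; have : 0 < sin a ^+ 2 by rewrite exprn_gt0.
  nra.
have l1 : 1 < 2 * cos a by nra.
have aE : a = (a / 2) *+ 2 by rewrite mulr2n; field.
have ch : cos a = 1 - 2 * sin (a / 2) ^+ 2.
  by rewrite {1}aE cos_mulr2n cos2sin2; ring.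
have sh2 : sin a = 2 * cos (a / 2) * sin (a / 2).
  by rewrite {1}aE sin_mulr2n; ring.
have half : (2 * cos a + 1)^-1 = sin (a / 2) / sin (a / 2 + a).
  have e2 : 2 * cos a + 1 = sin (a / 2 + a) / sin (a / 2).
    rewrite sinD sh2; have := sin2cos2 (a / 2) => h.
    apply: (mulIf (lt0r_neq0 sh)); rewrite divfK ?gt_eqF //.
    have -> : cos (a / 2) * (2 * cos (a / 2) * sin (a / 2)) =
      2 * cos (a / 2) ^+ 2 * sin (a / 2) by ring.
    have -> : cos (a / 2) ^+ 2 = 1 - sin (a / 2) ^+ 2 by lra.
    rewrite ch; ring.
  by rewrite e2 invf_div.
split.
- by rewrite l1 lt2.
- rewrite /beta zero iter_hstep_sin; last first.
    by move=> i im; apply: (@sin_pos 0 m.+1); rewrite ?lexx ?ltW.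
  rewrite !add0r ea sin_pihalf divr1.
  have -> : a * m.+1%:R = - (a - pi / 2) by rewrite -ea -(natr1 m.+1); ring.
  by rewrite sinN sinBpihalf opprK mulrAC divff ?mul1r.
- rewrite /alpha half iter_hstep_sin; last first.
    move=> i im; apply: (@sin_pos (a / 2) m) => //; apply/andP; split; lra.
  have -> : a / 2 + a * m.+1%:R = - (a / 2 - pi / 2).
    by rewrite -ea -(natr1 m.+1); field.
  have -> : a / 2 + a * m%:R = - ((a + a / 2) - pi / 2).
    by rewrite -ea -(natr1 m.+1) -(natr1 m); field.
  rewrite !sinN !sinBpihalf !opprK.
  have cpos : 0 < cos (a / 2) by apply: cos_gt0_pihalf; apply/andP; split; lra.
  apply: (mulIf (lt0r_neq0 cpos)); rewrite divfK ?gt_eqF //.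
  by rewrite cosD sh2 ch; ring.
- move=> k km; rewrite /beta {1}zero; apply: iter_hstep_sin_lt => i ik.
  by apply: (@sin_pos 0 k.+1); rewrite ?lexx ?ltW.
- move=> k km; rewrite /alpha half; apply: iter_hstep_sin_lt => i ik.
  by apply: (@sin_pos (a / 2) k.+1) => //; apply/andP; split; lra.
Qed.

Lemma hstepK {R : fieldType} (l y : R) : l - (hstep l y)^-1 = y.
Proof. by rewrite /hstep invrK opprB addrC subrK. Qed.

Lemma ler_hstep {R : realType} (l y z : R) : y <= z -> z < l ->
  hstep l y <= hstep l z.
Proof. by move=> yz zl; rewrite lef_pV2 ?posrE ?subr_gt0; lra. Qed.

Lemma ltr_hstep {R : realType} (l y z : R) : y < z -> z < l ->
  hstep l y < hstep l z.
Proof. by move=> yz zl; rewrite ltf_pV2 ?posrE ?subr_gt0; lra. Qed.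

Lemma alpha_ltS {R : realType} (m k : nat) (l : R) : hecke_orbits m l ->
  (k < m)%N -> alpha l k < alpha l k.+1.
Proof.
move=> [/andP[l1 l2] _ _ _ al] km; apply: (@iter_hstep_incr _ _ _ m) (ltnW km) => //.
have a0 : (l + 1)^-1 < l := al _ (leq0n _).
rewrite /hstep ltf_pV2 ?posrE ?subr_gt0 //; last lra.
have : 0 < (l + 1)^-1 by rewrite invr_gt0; lra.
lra.
Qed.

Lemma alpha_le {R : realType} (m i j : nat) (l : R) : hecke_orbits m l ->
  (i <= j)%N -> (j <= m)%N -> alpha l i <= alpha l j.
Proof.
move=> H; elim: j => [|j IH]; first by rewrite leqn0 => /eqP->.
rewrite leq_eqVlt => /orP[/eqP-> //|ij] jm.
by apply: (le_trans (IH _ _)) (ltW (alpha_ltS H _)) => //; lia.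
Qed.

Lemma alpha_bounds {R : realType} (m k : nat) (l : R) : hecke_orbits m l ->
  (k <= m)%N -> (l + 1)^-1 <= alpha l k <= l - 1.
Proof.
move=> H km; rewrite -[(l + 1)^-1]/(alpha l 0) (alpha_le H) //=.
by have [_ _ <- _ _] := H; rewrite (alpha_le H).
Qed.

Lemma alpha_gt0 {R : realType} (m k : nat) (l : R) : hecke_orbits m l ->
  (k <= m)%N -> 0 < alpha l k.
Proof.
move=> H km; have /andP[h _] := alpha_bounds H km.
have [/andP[l1 _] _ _ _ _] := H.
by apply: lt_le_trans h; rewrite invr_gt0; lra.
Qed.

(** One step back from [beta l m.+1 = l / 2]. The digit 1 branch sends [l / 2] to
    [2 / l - l = - beta l m], so positive points with digit 1 land above [- beta l m]. *)
Lemma rosen_lambda_hstep_beta {R : realType} (m : nat) (l : R) :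
  hecke_orbits m l -> beta l m = l - 2 / l.
Proof.
move=> [_ e _ _ _]; rewrite -[LHS](hstepK l) -[hstep _ _]/(beta l m.+1) e.
by rewrite invf_div.
Qed.

(** * One step of the Rosen map and of its natural extension *)

(** The digit rounds [1 / (l |t|)] to a nearest integer, so the remainder falls back into the
    interval. It is at least 1 because [1 / (l |t|) >= 2 / l^2 > 1 / 2]. *)
Lemma rosen_map_step {R : realType} (q : nat) (t : R) :
  0 < (rosen_lambda q : R) < 2 -> rosen_interval q t -> t != 0 ->
  [/\ rosen_interval q (rosen_map q t),
      `|t| * ((rosen_r q t)%:~R * rosen_lambda q + rosen_map q t) = 1
    & (rosen_r q t)%:~R = 1 :> R \/ 2 <= (rosen_r q t)%:~R :> R].
Proof.
rewrite /rosen_interval /rosen_map; set l : R := rosen_lambda q.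
move=> /andP[l0 l2] /andP[tl tu] tn0; rewrite (negbTE tn0) -/l.
have tp : 0 < `|t| by rewrite normr_gt0.
have tle : `|t| <= l / 2 by rewrite ler_norml tl ltW.
set w : R := 1 / `|t|; have wt : w * `|t| = 1 by rewrite /w divfK ?gt_eqF.
have ew : 1 / (l * `|t|) = w / l.
  by rewrite /w; field; rewrite !gt_eqF.
have rE : rosen_r q t = Num.floor (w / l + 1 / 2) by rewrite /rosen_r -/l ew.
set z := w / l; have zl : z * l = w by rewrite /z divfK ?gt_eqF.
have fle := floor_le (z + 1 / 2); have flt := floorD1_gt (z + 1 / 2).
rewrite -rE in fle flt.
rewrite [(_ + 1)%:~R]intrD in flt.
split.
- have h1 : 0 <= l * (z + 1 / 2 - (rosen_r q t)%:~R).
    by apply: mulr_ge0; [exact: ltW|rewrite subr_ge0].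
  have h2 : 0 < l * ((rosen_r q t)%:~R + 1 - (z + 1 / 2)).
    by apply: mulr_gt0; rewrite ?subr_gt0.
  rewrite -zl; apply/andP; split; lra.
- by rewrite -wt; ring.
- have z12 : 1 / 2 < z.
    have : l * z * `|t| = 1 by rewrite (mulrC l) zl.
    have zp : 0 < z by rewrite divr_gt0 // divr_gt0.
    move=> h.
    have : 1 <= l * z * (l / 2) by rewrite -{1}h ler_wpM2l // mulr_ge0 // ltW.
    nra.
  have r1 : (1 <= rosen_r q t).
    by rewrite rE floor_ge_int -/z [1%:~R]mulr1z; lra.
  have : (rosen_r q t = 1) \/ (2 <= rosen_r q t) by lia.
  case=> [->|h]; [by left|right].
  by rewrite -[2]/(2%:~R) ler_int.
Qed.

(* The fibre over [t] of the natural extension domain of [f_q]. *)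
Definition rosen_region {R : realType} (m : nat) (l t v : R) : Prop :=
  0 <= v <= 1 /\
  forall i, (i <= m)%N -> t < - beta l i -> v <= alpha l (m - i).

(** Here [d] is [S_(n+1) / S_n], so [d^-1] is the next [v]. The cases are the sign of [t] and
    whether the digit is 1. *)
Lemma rosen_region_step {R : realType} (m q : nat) (t v : R) :
  hecke_orbits m (rosen_lambda q : R) -> rosen_interval q t -> t != 0 ->
  rosen_region m (rosen_lambda q) t v ->
  let d := (rosen_r q t)%:~R * rosen_lambda q + Num.sg t * v in
  1 <= d /\ rosen_region m (rosen_lambda q) (rosen_map q t) d^-1.
Proof.
move=> H I t0 [/andP[v0 v1] reg].
have [/andP[l1 l2] bm am bl _] := H.
have [] := rosen_map_step _ I t0; first by apply/andP; split; lra.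
move: I; rewrite /rosen_interval.
move: H l1 l2 bm am bl reg; set l : R := rosen_lambda q => H l1 l2 bm am bl reg.
move=> /andP[tl tu] /andP[].
set t' := rosen_map q t; set r := _%:~R => tl' tu' e r12.
set d := r * l + Num.sg t * v.
suff [d1 h] : 1 <= d /\ forall i, (i <= m)%N -> t' < - beta l i ->
    d^-1 <= alpha l (m - i).
  split=> //; split=> //; rewrite invr_ge0 invf_le1; lra.
have dle (c : R) : 0 < c -> c <= d -> d^-1 <= c^-1.
  by move=> c0 cd; rewrite lef_pV2 ?posrE //; lra.
(* Digits of at least 2 give [d >= l + 1], hence [d^-1 <= alpha l 0], the least of all the
   bounds. *)
have small : l + 1 <= d -> forall i, (i <= m)%N -> d^-1 <= alpha l (m - i).
  move=> dl i im; apply: (le_trans (dle _ _ dl)); first lra.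
  by have /andP[] := alpha_bounds H (leq_subr i m).
case: (ltrgt0P t) t0 e => // ts _ e.
- have ed : d = r * l + v by rewrite /d gtr0_sg // mul1r.
  have [r1|r2] := r12; last first.
    have dl : l + 1 <= d by rewrite ed; nra.
    by split; [lra|move=> i im _; apply: small].
  move: e ed; rewrite r1 mul1r => e ed.
  split; first lra.
  (* [t < l / 2] gives [t' > 2 / l - l = - beta l m], so [i = m] cannot occur and
     [d^-1 <= 1 / l < alpha l 1] suffices. *)
  move=> i im ti; have im' : (i < m)%N.
    rewrite ltn_neqAle im andbT; apply/negP => /eqP im'.
    move: ti; rewrite im' (rosen_lambda_hstep_beta H) => ti.
    have h2 : 2 / l * l = 2 by rewrite divfK //; apply/eqP; lra.
    nra.
  apply: (@le_trans _ _ (alpha l 1)); last by apply: (alpha_le H); rewrite ?subn_gt0 ?leq_subr.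
  rewrite /alpha iterS /=; apply: dle.
    by have [_ _ _ _ /(_ 0 isT)] := H; rewrite subr_gt0.
  have : 0 < (l + 1)^-1 by rewrite invr_gt0; lra.
  lra.
- have ed : d = r * l - v by rewrite /d ltr0_sg // mulN1r.
  have vl : v <= l - 1.
    by rewrite -am -{1}(subn0 m); apply: reg => //; rewrite /beta /= oppr0.
  have [r1|r2] := r12; last first.
    have dl : l + 1 <= d by rewrite ed; nra.
    by split; [lra|move=> i im _; apply: small].
  move: e ed; rewrite r1 mul1r => e ed; split; first lra.
  move=> i im ti.
  have et : - t = hstep l (- t').
    have nz : l + t' != 0 by apply/eqP => h; move: e; rewrite h mulr0; lra.
    by apply: (mulIf nz); rewrite /hstep opprK mulVf.
  (* Pulling [t' < - beta l i] back raises the index to [i.+1]; then [v <= alpha l (m - i.+1)] steps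
     forward to the required bound on [d^-1]. At [i = m] the pullback contradicts [- l / 2 <= t]. *)
  have : beta l i.+1 < - t.
    by rewrite et /beta iterS -/(beta l i); apply: ltr_hstep; lra.
  have im' : (i < m)%N -> t < - beta l i.+1 -> v <= alpha l (m - i.+1).
    by move=> h; apply: reg.
  move: im; rewrite leq_eqVlt => /orP[/eqP->|im]; first by rewrite bm; lra.
  move=> h; have /im' : (i < m)%N by []; rewrite ltrNr => /(_ h) vi.
  rewrite -(subnSK im).
  rewrite /alpha iterS ed; apply: ler_hstep => //.
  by have [_ _ _ _ ] := H; apply; apply: leq_subr.
Qed.

(** * Convergents and approximation coefficients along an orbit *)

Lemma rosen_orbit {R : realType} (q : nat) (x : R) (n : nat) :
  0 < (rosen_lambda q : R) < 2 -> rosen_interval q x -> Gq_irrational q x ->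
  rosen_interval q (iter n (rosen_map q) x) /\ iter n (rosen_map q) x != 0.
Proof.
move=> lb I irr.
have nz k : iter k (rosen_map q) x != 0 by apply/eqP => h; apply: irr; exists k.
split=> //; elim: n => [//|n IH]; rewrite iterS.
by have [] := rosen_map_step lb IH (nz n).
Qed.

Definition rosen_v {R : realType} (q : nat) (x : R) (n : nat) : R :=
  (rosen_rec q x 0 1 n).1 / (rosen_rec q x 0 1 n).2.

Lemma rosen_vS {R : realType} (q : nat) (x : R) (n : nat) :
  rosen_S q x n != 0 ->
  rosen_v q x n.+1 = ((rosen_r_digit q x n.+1)%:~R * rosen_lambda q
                      + rosen_eps_digit q x n.+1 * rosen_v q x n)^-1.
Proof.
rewrite /rosen_v /rosen_S /=; set u := rosen_rec _ _ _ _ _ => u2.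
rewrite -[LHS]invf_div; congr _^-1.
by rewrite mulrDl mulfK // mulrA.
Qed.

(** The region contains the start [(x, 0)] and is invariant; [S_n] stays positive since each step
    multiplies it by [d >= 1]. *)
Lemma rosen_region_orbit {R : realType} (m q : nat) (x : R) (n : nat) :
  hecke_orbits m (rosen_lambda q : R) ->
  rosen_interval q x -> Gq_irrational q x ->
  0 < rosen_S q x n /\
  rosen_region m (rosen_lambda q) (iter n (rosen_map q) x) (rosen_v q x n).
Proof.
move=> H I irr; have [/andP[l1 l2] _ _ _ _] := H.
have lb : 0 < (rosen_lambda q : R) < 2 by apply/andP; split; lra.
elim: n => [|n [IH1 IH2]].
  split; first by rewrite /rosen_S ltr01.
  rewrite /rosen_v /= mul0r; split; first by rewrite lexx ler01.
  by move=> i im _; apply: ltW; apply: (alpha_gt0 H); lia.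
have [In tn] := rosen_orbit n lb I irr.
have [] := rosen_region_step H In tn IH2.
rewrite iterS rosen_vS ?gt_eqF //.
rewrite /rosen_r_digit /rosen_eps_digit -pred_Sn => d1 h; split=> //.
have -> : rosen_S q x n.+1 = rosen_S q x n *
   ((rosen_r q (iter n (rosen_map q) x))%:~R * rosen_lambda q
     + Num.sg (iter n (rosen_map q) x) * rosen_v q x n).
  move: IH1; rewrite /rosen_S /rosen_v /=.
  set u := rosen_rec _ _ _ _ _ => u2; rewrite /rosen_r_digit /rosen_eps_digit /=.
  by field; rewrite gt_eqF.
by rewrite mulr_gt0 //; lra.
Qed.

(** The first identity is [x = (R_n + t R_(n-1)) / (S_n + t S_(n-1))], cleared of denominators; the
    second carries the information that [R_(n-1) S_n - R_n S_(n-1)] is 1 or -1. *)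
Lemma rosen_error {R : realType} (q : nat) (x : R) (n : nat) :
  0 < (rosen_lambda q : R) < 2 -> rosen_interval q x -> Gq_irrational q x ->
  let u := rosen_rec q x 0 1 n in let w := rosen_rec q x 1 0 n in
  let t := iter n (rosen_map q) x in
  x * u.2 - w.2 = - t * (x * u.1 - w.1) /\
  `|x * u.1 - w.1| * (u.2 + t * u.1) = 1.
Proof.
move=> lb I irr; elim: n => [|n]; rewrite /= /rosen_r_digit /rosen_eps_digit /=.
  by split; [ring|rewrite mulr0 sub0r normrN normr1 addr0 mulr1].
have [In tn] := rosen_orbit n lb I irr.
have [_ e _] := rosen_map_step lb In tn.
move: e; set t := iter n _ x; set t' := rosen_map q t; set r := _%:~R.
set l := rosen_lambda q; set u := rosen_rec q x 0 1 n.
set w := rosen_rec q x 1 0 n => e [e1 e2].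
have tp : `|t| != 0 by rewrite normr_eq0.
have sgt : Num.sg t * t = `|t| by rewrite -normrEsg.
have sgD : Num.sg t * (x * u.1 - w.1) * `|t| = - (x * u.2 - w.2).
  rewrite e1 mulNr opprK normrEsg; have : Num.sg t * Num.sg t = 1.
    by rewrite -expr2 sqr_sg tn.
  by move=> s2; rewrite -[RHS]mul1r -s2; ring.
split.
- apply: (mulIf tp).
  have -> : (x * (r * l * u.2 + Num.sg t * u.1) - (r * l * w.2 + Num.sg t * w.1)) * `|t| =
    r * l * (x * u.2 - w.2) * `|t| + Num.sg t * (x * u.1 - w.1) * `|t| by ring.
  rewrite sgD -[X in _ + - X]mul1r -e; ring.
- rewrite -e2 e1 normrM normrN.
  have -> : r * l * u.2 + Num.sg t * u.1 + t' * u.2 = (r * l + t') * u.2 + Num.sg t * u.1.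
    by ring.
  have -> : `|t| * `|x * u.1 - w.1| * ((r * l + t') * u.2 + Num.sg t * u.1) =
     `|x * u.1 - w.1| * (`|t| * (r * l + t') * u.2 + Num.sg t * `|t| * u.1) by ring.
  by rewrite e mul1r -numEsg.
Qed.

(** Combine both identities of [rosen_error] and divide by [S_n]. The denominator is positive
    because [|t| < 1] and [0 <= v <= 1]. *)
Lemma rosen_ThetaE {R : realType} (m q : nat) (x : R) (n : nat) :
  hecke_orbits m (rosen_lambda q : R) ->
  rosen_interval q x -> Gq_irrational q x ->
  let t := iter n (rosen_map q) x in let v := rosen_v q x n in
  0 < 1 + t * v /\ rosen_Theta q x n = `|t| / (1 + t * v).
Proof.
move=> H I irr t v; have [/andP[l1 l2] _ _ _ _] := H.
have lb : 0 < (rosen_lambda q : R) < 2 by apply/andP; split; lra.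
have [S0 [/andP[v0 v1] _]] := rosen_region_orbit n H I irr.
have [/andP[tl tu] _] := rosen_orbit n lb I irr.
have d0 : 0 < 1 + t * v by rewrite -/t -/v in tl tu v0 v1; nra.
split=> //; have [e1 e2] := rosen_error n lb I irr.
move: e1 e2 S0; rewrite /v /rosen_v -/t /rosen_Theta /rosen_S /rosen_R.
set u := rosen_rec _ _ 0 1 _; set w := rosen_rec _ _ 1 0 _ => e1 e2 S0.
have un : u.2 != 0 by rewrite gt_eqF.
have -> : x - w.2 / u.2 = (x * u.2 - w.2) / u.2 by field.
have us : u.2 + t * u.1 = u.2 * (1 + t * v) by rewrite /v /rosen_v; field.
rewrite normrM e1 normrM normrN normfV (gtr0_norm S0).
rewrite us in e2; apply: (mulIf (lt0r_neq0 d0)).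
rewrite -/(rosen_v q x n) -/v divfK ?gt_eqF // -[RHS]mulr1 -[X in _ = _ * X]e2.
by field.
Qed.

(** * Orbits that stay negative *)

Lemma expr_eventually_lt {R : realType} (z e : R) : 0 <= z < 1 -> 0 < e ->
  exists N, forall n, (N <= n)%N -> z ^+ n < e.
Proof.
move=> /andP[z0 z1] e0; have zn : `|z| < 1 by rewrite ger0_norm.
have /cvgrPdist_lt /(_ e e0) [N _ h] := cvg_expr zn.
exists N => n /h /=; rewrite sub0r normrN ger0_norm //.
exact: exprn_ge0.
Qed.

Lemma Gq_irrational_iter {R : realType} (q : nat) (x : R) (n : nat) :
  Gq_irrational q x -> Gq_irrational q (iter n (rosen_map q) x).
Proof. by move=> irr [k]; rewrite -iterD => h; apply: irr; exists (k + n)%N. Qed.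

Lemma rosen_neg_step {R : realType} (q : nat) (t : R) :
  1 < (rosen_lambda q : R) < 2 -> rosen_interval q t -> t < 0 ->
  - t = hstep ((rosen_r q t)%:~R * rosen_lambda q) (- rosen_map q t).
Proof.
move=> /andP[l1 l2] I t0.
have [] := rosen_map_step _ I (ltr0_neq0 t0); first by apply/andP; split; lra.
rewrite ltr0_norm // => _ e _.
rewrite /hstep opprK; set d := (_ + _) in e *.
have nz : d != 0 by apply/eqP => h; move: e; rewrite h mulr0; lra.
by apply: (mulIf nz); rewrite mulVf.
Qed.

Lemma hecke_orbits_pos {R : realType} (m : nat) (l : R) : hecke_orbits m l ->
  0 < l < 2.
Proof. by move=> [/andP[l1 l2] _ _ _ _]; apply/andP; split; lra. Qed.

(** The inequality [f_q^i(y) < 0] is pulled back through [i] digits 1, each time by the increasing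
    map [hstep l]. *)
Lemma neg_orbit_digit {R : realType} (m q i : nat) (y : R) :
  hecke_orbits m (rosen_lambda q : R) -> (i <= m.+1)%N ->
  rosen_interval q y -> Gq_irrational q y ->
  (forall k, iter k (rosen_map q) y < 0) ->
  (forall k, (rosen_r q (iter k (rosen_map q) y))%:~R = 1 :> R) ->
  beta (rosen_lambda q) i < - y.
Proof.
move=> H; have lb := hecke_orbits_pos H; have [l12 _ _ bl _] := H.
elim: i y => [|i IH] y im I irr neg r1.
  by rewrite /beta /= oppr_gt0; apply: (neg 0%N).
have e := rosen_neg_step l12 I (neg 0%N).
have [/andP[I1 I2] _ _] := rosen_map_step lb I (ltr0_neq0 (neg 0%N)).
have {}IH : beta (rosen_lambda q) i < - rosen_map q y.
  apply: IH; first exact: ltnW.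
  - by rewrite /rosen_interval I1 I2.
  - exact: (Gq_irrational_iter (n := 1%N)).
  - by move=> k; rewrite -iterSr; apply: neg.
  - by move=> k; rewrite -iterSr; apply: r1.
rewrite e (r1 0%N) mul1r /beta iterS; apply: ltr_hstep => //.
move: I1 I2; have /andP[] := lb; lra.
Qed.

(** With digits 1 only, [neg_orbit_digit] at [i = m + 1] would place [y] below [- l / 2]. *)
Lemma neg_orbit_digit_ge2 {R : realType} (m q : nat) (y : R) :
  hecke_orbits m (rosen_lambda q : R) ->
  rosen_interval q y -> Gq_irrational q y ->
  (forall k, iter k (rosen_map q) y < 0) ->
  exists k, 2 <= (rosen_r q (iter k (rosen_map q) y))%:~R :> R.
Proof.
move=> H I irr neg; have lb := hecke_orbits_pos H.
apply: contrapT => no.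
have r1 k : (rosen_r q (iter k (rosen_map q) y))%:~R = 1 :> R.
  have [Ik tk] := rosen_orbit k lb I irr.
  by have [_ _ [//|r2]] := rosen_map_step lb Ik tk; case: no; exists k.
have := neg_orbit_digit H (leqnn _) I irr neg r1.
have [_ -> _ _ _] := H; move: I => /andP[]; lra.
Qed.

Lemma hstepB {R : realType} (l y z : R) : y < l -> z < l ->
  hstep l y - hstep l z = (y - z) * (hstep l y * hstep l z).
Proof. by move=> yl zl; rewrite /hstep; field; rewrite !subr_eq0 !gt_eqF. Qed.

(* The orbit shadows the periodic orbit alpha m, ..., alpha 0, alpha m, ... from
   above, and each step multiplies the gap by at least (2/l)^2 > 1; the upper
   bound by beta rules out a further digit 1 at j = 0. *)
Lemma neg_orbit_gap {R : realType} (m q k : nat) (y : R) :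
  hecke_orbits m (rosen_lambda q : R) ->
  rosen_interval q y -> Gq_irrational q y ->
  (forall k, iter k (rosen_map q) y < 0) ->
  alpha (rosen_lambda q) m < - y ->
  let t := iter k (rosen_map q) y in
  exists j, [/\ (j <= m)%N, alpha (rosen_lambda q) j < - t,
    - t <= beta (rosen_lambda q) j.+1 &
    - y - alpha (rosen_lambda q) m <=
      (rosen_lambda q / 2) ^+ 2 ^+ k * (- t - alpha (rosen_lambda q) j)].
Proof.
move=> H I irr neg y0; have lb := hecke_orbits_pos H.
have [l12 bm am bl al] := H.
elim: k => [|k]; rewrite /=.
  exists m; rewrite expr0 mul1r bm; split=> //; move: I => /andP[]; lra.
set t := iter k _ y; set t' := rosen_map q t.
have [It tn] := rosen_orbit k lb I irr.
have [I' _] := rosen_orbit k.+1 lb I irr.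
have e : - t = hstep _ (- t') := rosen_neg_step l12 It (neg k).
have t0 : t < 0 := neg k; have t0' : t' < 0 := neg k.+1.
have [_ _ r12] := rosen_map_step lb It tn; rewrite -/t in r12.
move: It I' e r12; rewrite /rosen_interval [iter k.+1 _ _]/= -/t -/t'.
move: H l12 lb bm am bl al; set l : R := rosen_lambda q; set r : R := _%:~R.
move=> H /andP[l1 l2] lb bm am bl al /andP[tl tu] /andP[tl' tu'] e r12.
have rl : - t' < r * l by case: r12 => [->|r2]; nra.
have d0 : 0 < r * l + t' by lra.
have e1 : - t * (r * l + t') = 1 by rewrite e /hstep opprK mulVf // gt_eqF.
move=> [j [jm h1 h2 h3]].
have aj : 0 < alpha l j <= l - 1.
  by rewrite (alpha_gt0 H jm); have /andP[] := alpha_bounds H jm.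
(* This product bounds the ratio of the old gap to the new one. Both factors are at most [l / 2], as
   [l - 1 < l / 2]. *)
have contr : - t * alpha l j <= (l / 2) ^+ 2.
  by rewrite expr2; apply: ler_pM; case/andP: aj; lra.
suff [j' [jm' h1' h2' h3']] : exists j', [/\ (j' <= m)%N, alpha l j' < - t',
    - t' <= beta l j'.+1 &
    - t - alpha l j <= (- t' - alpha l j') * (- t * alpha l j)].
  exists j'; split=> //; apply: (le_trans h3).
  rewrite [_ ^+ k.+1]exprSr -mulrA; apply: ler_wpM2l.
    by apply: exprn_ge0; apply: exprn_ge0; lra.
  by apply: (le_trans h3'); rewrite mulrC; apply: ler_wpM2r => //; lra.
case: j jm h1 h2 aj {h3} contr => [|j] jm h1 h2 /andP[a0 al1] contr.
- have a0E : alpha l 0 * (l + 1) = 1 by rewrite mulVf // gt_eqF //; lra.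
  have r2 : 2 <= r.
    case: r12 => // r1; move: e1; rewrite r1 mul1r => e1.
    have : - t * l <= 1.
      have <- : beta l 1 * l = 1.
        by rewrite /beta /= /hstep subr0 mulVf // gt_eqF //; lra.
      by rewrite ler_wpM2r //; lra.
    have : 0 < - t * - t' by rewrite mulr_gt0 //; lra.
    lra.
  (* [- t > 1 / (l + 1)] forces [r l + t' < l + 1]; with [r >= 2] the orbit is again above
     [alpha l m], and the cycle restarts. *)
  have tt : l - 1 < - t'.
    have : 1 < - t * (l + 1) by rewrite -{1}a0E ltr_pM2r //; lra.
    rewrite -{1}e1 ltr_pM2l; last lra.
    have : 0 <= (r - 2) * l by rewrite mulr_ge0 //; lra.
    lra.
  exists m; rewrite am bm; split=> //; first lra.
  have -> : - t - alpha l 0 = (l + 1 - (r * l + t')) * (- t * alpha l 0).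
    transitivity (- t * (alpha l 0 * (l + 1)) - (- t * (r * l + t')) * alpha l 0).
      by rewrite a0E e1; ring.
    by ring.
  apply: ler_wpM2r; first by rewrite mulr_ge0 //; lra.
  have : 0 <= (r - 2) * l by rewrite mulr_ge0 //; lra.
  lra.
- have ajl : alpha l j < l by apply: al; apply: ltnW.
  have aj0 : 0 < alpha l j by apply: (alpha_gt0 H); apply: ltnW.
  have aE : alpha l j.+1 = hstep l (alpha l j) by [].
  have bE : beta l j.+2 = hstep l (beta l j.+1) by [].
  have a1E : alpha l j.+1 * (l - alpha l j) = 1 by rewrite mulVf // gt_eqF // subr_gt0.
  (* A digit of at least 2 would give [r l + t' > l], whereas [- t > alpha l j.+1] forces
     [r l + t' < l - alpha l j]. *)
  have r1 : r = 1.
    case: r12 => // r2.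
    have : 1 < - t * (l - alpha l j) by rewrite -{1}a1E ltr_pM2r // subr_gt0.
    rewrite -{1}e1 ltr_pM2l; last lra.
    have : 0 <= (r - 2) * l by rewrite mulr_ge0 //; lra.
    lra.
  rewrite r1 mul1r in e rl; exists j; split.
  + exact: ltnW.
  + rewrite ltNge; apply/negP => h.
    by move: h1; rewrite aE e ltNge ler_hstep.
  + rewrite leNgt; apply/negP => h.
    by move: h2; rewrite bE e leNgt ltr_hstep.
  + by rewrite aE {1}e hstepB // -e.
Qed.

(** Otherwise [neg_orbit_gap] bounds the positive excess of [- y] over [alpha m = l - 1] by
    [(l / 2)^(2 k)] for every [k], because [- t - alpha j < 1]. *)
Lemma neg_orbit_le {R : realType} (m q : nat) (y : R) :
  hecke_orbits m (rosen_lambda q : R) ->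
  rosen_interval q y -> Gq_irrational q y ->
  (forall k, iter k (rosen_map q) y < 0) ->
  - y <= rosen_lambda q - 1.
Proof.
move=> H I irr neg; rewrite leNgt; apply/negP; have [/andP[l1 l2] _ am _ _] := H.
rewrite -am => y0.
have z1 : 0 <= (rosen_lambda q / 2 : R) ^+ 2 < 1.
  apply/andP; split; first by rewrite exprn_ge0 //; lra.
  by rewrite expr_lt1 //; lra.
have gap0 : 0 < - y - alpha (rosen_lambda q) m by rewrite subr_gt0.
have [N /(_ N (leqnn N)) zN] := expr_eventually_lt z1 gap0.
have [j [jm h1 h2 h3]] := neg_orbit_gap N H I irr neg y0.
have [/andP[tl tu] _] := rosen_orbit N (hecke_orbits_pos H) I irr.
have aj := alpha_gt0 H jm.
move: zN; rewrite ltNge => /negP; apply; apply: (le_trans h3).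
rewrite ler_piMr //; last lra.
by apply: exprn_ge0; case/andP: z1.
Qed.

(** * The bound 1/2 is met infinitely often *)

(** Expressed at index [n + 1] so as to share its denominator with [Theta_(n+1)]. It rests on
    [d + y' = (1 + y w) / |y|], where [d = S_(n+1) / S_n]. *)
Lemma rosen_Theta_prev {R : realType} (m q : nat) (x : R) (n : nat) :
  hecke_orbits m (rosen_lambda q : R) ->
  rosen_interval q x -> Gq_irrational q x ->
  let t := iter n.+1 (rosen_map q) x in let v := rosen_v q x n.+1 in
  rosen_Theta q x n = v / (1 + t * v).
Proof.
move=> H I irr t v; have lb := hecke_orbits_pos H.
have [d0' _] := rosen_ThetaE n.+1 H I irr; have [d0 ->] := rosen_ThetaE n H I irr.
have [S0 reg] := rosen_region_orbit n H I irr.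
have [It tn] := rosen_orbit n lb I irr.
have [_ e _] := rosen_map_step lb It tn.
have [d1 _] := rosen_region_step H It tn reg.
move: d0'; rewrite -/t -/v /v rosen_vS ?gt_eqF // /t iterS.
rewrite /rosen_r_digit /rosen_eps_digit -pred_Sn.
move: e d1 tn d0; set y := iter n _ x; set r : R := _%:~R; set l := rosen_lambda q.
set w := rosen_v q x n; set y' := rosen_map q y => e d1 tn d0.
set d := r * l + _ => d0'.
have dp : 0 < d by apply: lt_le_trans d1.
have y0 : 0 < `|y| by rewrite normr_gt0.
have -> : d^-1 / (1 + y' / d) = (d + y')^-1.
  have : d + y' != 0.
    rewrite gt_eqF //; move: d0'.
    have -> : 1 + y' / d = (d + y') / d by field; rewrite gt_eqF.
    by rewrite pmulr_lgt0 // invr_gt0.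
  by move=> h; field; rewrite h gt_eqF //= mul1r h.
have -> : d + y' = (1 + y * w) / `|y|.
  apply: (mulIf (lt0r_neq0 y0)); rewrite divfK ?gt_eqF // -e /d.
  have -> : y * w = Num.sg y * `|y| * w by rewrite -numEsg.
  by ring.
by rewrite invf_div.
Qed.

Lemma rosen_Theta_le_half {R : realType} (m q : nat) (x : R) (N : nat) :
  hecke_orbits m (rosen_lambda q : R) ->
  rosen_interval q x -> Gq_irrational q x ->
  exists n, (N <= n)%N /\ rosen_Theta q x n <= 1 / 2.
Proof.
move=> H I irr; have lb := hecke_orbits_pos H; apply: contrapT => no.
have big n : (N <= n)%N -> 1 / 2 < rosen_Theta q x n.
  by move=> Nn; rewrite ltNge; apply/negP => h; apply: no; exists n.
(* The inequality [N < n] is strict because [Theta_(n-1)] is used along with [Theta_n]. *)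
have neg n : (N < n)%N -> iter n (rosen_map q) x < 0.
  case: n => [//|n] Nn.
  have [/andP[tl tu] tn] := rosen_orbit n.+1 lb I irr.
  have := big n Nn; have := big n.+1 (leqW Nn).
  have [d0 ->] := rosen_ThetaE n.+1 H I irr; rewrite (rosen_Theta_prev _ H I irr).
  rewrite !(ltr_pdivlMr _ _ d0); move: tn tl tu d0; set t := iter n.+1 _ x.
  set v := rosen_v q x n.+1; case: (ltrgt0P t) => // t0 _ tl tu d0 h1 h2.
  have t1 : 0 < 2 - t by have /andP[] := lb; lra.
  (* The multipliers [2 - t] and [t] eliminate [v]: the two products add up to [- 2 (t - 1)^2]. *)
  have : 0 < (2 - t) * (2 * t - (1 + t * v)) by rewrite mulr_gt0 //; lra.
  have : 0 < t * (2 * v - (1 + t * v)) by rewrite mulr_gt0 //; lra.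
  have := sqr_ge0 (t - 1); rewrite expr2; lra.
set y := iter N.+1 (rosen_map q) x.
have iterE k : iter k (rosen_map q) y = iter (k + N.+1) (rosen_map q) x.
  by rewrite iterD.
have negy k : iter k (rosen_map q) y < 0.
  by rewrite iterE; apply: neg; rewrite addnS ltnS leq_addl.
have [Iy _] := rosen_orbit N.+1 lb I irr.
have [k] := neg_orbit_digit_ge2 H Iy (Gq_irrational_iter irr) negy.
rewrite -/y iterE; set n := (k + N.+1)%N => r2.
have Nn : (N < n)%N by rewrite /n addnS ltnS leq_addl.
have := big n (ltnW Nn); have [d0 ->] := rosen_ThetaE n H I irr.
have [It tn] := rosen_orbit n lb I irr.
have [I' _] := rosen_orbit n.+1 lb I irr.
have t'le : - iter n.+1 (rosen_map q) x <= rosen_lambda q - 1.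
  apply: (neg_orbit_le H I' (Gq_irrational_iter irr)) => j.
  by rewrite -iterD; apply: neg; rewrite addnS ltnS (leq_trans (ltnW Nn)) // leq_addl.
have [_ e _] := rosen_map_step lb It tn.
(* Index 0 of the region: [t < - beta 0 = 0] yields [v <= alpha m = l - 1]. *)
have [_ [_ /(_ 0%N (leq0n _))]] := rosen_region_orbit n H I irr.
have t0 := neg n Nn; rewrite /beta /= oppr0 => /(_ t0); rewrite subn0.
have [/andP[l1 l2] _ -> _ _] := H => vle.
rewrite ltr_pdivlMr //; move: e r2 t'le t0 vle; rewrite iterS.
set t := iter n _ x; set v := rosen_v q x n; set r : R := _%:~R; set l : R := rosen_lambda q.
move=> e r2 t'le t0 vle; rewrite (ltr0_norm t0) in e *.
have rl : 2 * l <= r * l by rewrite ler_wpM2r //; move: l1; rewrite -/l; lra.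
(* With [r >= 2] and both [- t'] and [v] at most [l - 1], the bracket is at least
   [2 l - 2 (l - 1) - 2 = 0]. *)
have : 0 <= - t * (r * l + rosen_map q t - v - 2) by rewrite mulr_ge0 //; lra.
lra.
Qed.

(** * The periodic orbit and optimality of 1/2 *)

(** Recognises digit and image from a candidate pair: [s / l] lies in [[-1/2, 1/2)], so the rounding
    returns [k]. *)
Lemma rosen_mapE {R : realType} (q : nat) (t s : R) (k : int) :
  1 < (rosen_lambda q : R) < 2 ->
  `|t| * (k%:~R * rosen_lambda q + s) = 1 -> rosen_interval q s ->
  rosen_r q t = k /\ rosen_map q t = s.
Proof.
move=> /andP[l1 l2] e /andP[s1 s2].
have tn : `|t| != 0 by apply/eqP => h; move: e; rewrite h mul0r; lra.
have inv : 1 / `|t| = k%:~R * rosen_lambda q + s.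
  by apply: (mulIf tn); rewrite divfK // mulrC e.
have rk : rosen_r q t = k.
  apply: floor_def.
  have -> : 1 / (rosen_lambda q * `|t|) = k%:~R + s / rosen_lambda q.
    have -> : 1 / (rosen_lambda q * `|t|) = (1 / `|t|) / rosen_lambda q.
      by field; rewrite tn gt_eqF //; lra.
    by rewrite inv; field; rewrite gt_eqF //; lra.
  have : - (1 / 2) <= s / rosen_lambda q by rewrite ler_pdivlMr; lra.
  have : s / rosen_lambda q < 1 / 2 by rewrite ltr_pdivrMr; lra.
  rewrite [(k + 1)%:~R]intrD => h1 h2; apply/andP; split; lra.
split=> //; rewrite /rosen_map rk ifF; last by rewrite -normr_eq0 (negbTE tn).
by rewrite inv; ring.
Qed.

Lemma alpha_interval {R : realType} (m q j : nat) :
  hecke_orbits m (rosen_lambda q : R) -> (j <= m)%N ->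
  rosen_interval q (- alpha (rosen_lambda q : R) j).
Proof.
move=> H jm; have := alpha_gt0 H jm; have /andP[_] := alpha_bounds H jm.
have [/andP[l1 l2] _ _ _ _] := H => h1 h2; apply/andP; split; lra.
Qed.

Lemma rosen_alpha0 {R : realType} (m q : nat) :
  hecke_orbits m (rosen_lambda q : R) ->
  rosen_r q (- alpha (rosen_lambda q : R) 0) = 2 /\
  rosen_map q (- alpha (rosen_lambda q : R) 0) = - alpha (rosen_lambda q) m.
Proof.
move=> H; have [l12 _ am _ _] := H; have /andP[l1 l2] := l12.
apply: rosen_mapE => //; last exact: (alpha_interval H).
rewrite normrN (gtr0_norm (alpha_gt0 H (leq0n _))) am.
have -> : 2%:~R * rosen_lambda q + - (rosen_lambda q - 1) = rosen_lambda q + 1 :> R.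
  by ring.
by rewrite mulVf // gt_eqF //; lra.
Qed.

Lemma rosen_alphaS {R : realType} (m q j : nat) :
  hecke_orbits m (rosen_lambda q : R) -> (j < m)%N ->
  rosen_r q (- alpha (rosen_lambda q : R) j.+1) = 1 /\
  rosen_map q (- alpha (rosen_lambda q : R) j.+1) = - alpha (rosen_lambda q) j.
Proof.
move=> H jm; have [l12 _ am _ al] := H; have /andP[l1 l2] := l12.
apply: rosen_mapE => //; last exact: (alpha_interval H (ltnW jm)).
rewrite normrN (gtr0_norm (alpha_gt0 H jm)) mulr1z mul1r.
by rewrite mulVf // gt_eqF // subr_gt0 al // ltnW.
Qed.

Lemma alpha_orbit {R : realType} (m q n : nat) :
  hecke_orbits m (rosen_lambda q : R) ->
  exists2 j, (j <= m)%N & iter n (rosen_map q) (- alpha (rosen_lambda q) m)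
                          = - alpha (rosen_lambda q : R) j.
Proof.
move=> H; elim: n => [|n [j jm]]; first by exists m.
rewrite iterS => ->; case: j jm => [|j] jm.
  by exists m => //; have [] := rosen_alpha0 H.
by exists j; [apply: ltnW|have [] := rosen_alphaS H jm].
Qed.

Lemma alpha_irrational {R : realType} (m q : nat) :
  hecke_orbits m (rosen_lambda q : R) ->
  Gq_irrational q (- alpha (rosen_lambda q : R) m).
Proof.
move=> H [n]; have [j jm ->] := alpha_orbit n H => /eqP.
by rewrite oppr_eq0 gt_eqF // (alpha_gt0 H).
Qed.

(** [alpha (m - j)] is the cycle run backwards and obeys the same recurrence as [v]. Hence [v]
    approaches it from below, the gap shrinking by a product of two numbers at most
    [l - 1 < l / 2]. *)
Lemma alpha_orbit_v {R : realType} (m q n : nat) :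
  hecke_orbits m (rosen_lambda q : R) ->
  let x : R := - alpha (rosen_lambda q) m in
  exists j, [/\ (j <= m)%N,
    iter n (rosen_map q) x = - alpha (rosen_lambda q) j,
    rosen_v q x n <= alpha (rosen_lambda q) (m - j) &
    alpha (rosen_lambda q) (m - j) - rosen_v q x n <= (rosen_lambda q / 2) ^+ 2 ^+ n].
Proof.
move=> H x; have lb := hecke_orbits_pos H; have [l12 _ am _ al] := H.
have /andP[l1 l2] := l12.
have I : rosen_interval q x := alpha_interval H (leqnn m).
have irr := alpha_irrational H; rewrite -/x in irr.
elim: n => [|n [j [jm tE vle gap]]].
  have a0 := alpha_gt0 H (leq0n m).
  exists m; rewrite subnn /rosen_v /= mul0r subr0 expr0; split=> //; first exact: ltW.
  by rewrite /alpha /= invf_le1; lra.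
have [S0 [/andP[v0 v1] _]] := rosen_region_orbit n H I irr.
have aj := alpha_gt0 H jm.
(* [c] is the current digit times lambda: [2 l] at [j = 0], where [j'] returns to [m], and [l]
   otherwise. *)
suff [j' [c [jm' tE' wE' vE' cw]]] : exists j' c, [/\ (j' <= m)%N,
    iter n.+1 (rosen_map q) x = - alpha (rosen_lambda q) j',
    alpha (rosen_lambda q) (m - j') = hstep c (alpha (rosen_lambda q) (m - j)),
    rosen_v q x n.+1 = hstep c (rosen_v q x n) &
    alpha (rosen_lambda q) (m - j) < c].
  have h1 : rosen_v q x n.+1 <= alpha (rosen_lambda q) (m - j').
    by rewrite wE' vE'; apply: ler_hstep.
  exists j'; split=> //.
  have vp : 0 < rosen_v q x n.+1.
    by rewrite vE' invr_gt0 subr_gt0 (le_lt_trans vle).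
  have /andP[_ wle] := alpha_bounds H (leq_subr j' m).
  rewrite [_ ^+ n.+1]exprSr wE' vE' hstepB // -?wE' -?vE'; last exact: le_lt_trans vle cw.
  apply: ler_pM => //; first by rewrite subr_ge0.
    by rewrite mulr_ge0 //; lra.
  by rewrite expr2; apply: ler_pM; lra.
rewrite rosen_vS ?gt_eqF // /rosen_r_digit /rosen_eps_digit -pred_Sn iterS tE.
rewrite ltr0_sg ?oppr_lt0 // mulN1r.
case: j jm aj tE vle gap => [|j] jm aj tE vle gap.
  have [-> ->] := rosen_alpha0 H; exists m, (2 * rosen_lambda q).
  rewrite subnn subn0 am; split=> //; last lra.
  by rewrite /alpha /hstep /=; congr _^-1; lra.
have [-> ->] := rosen_alphaS H jm; exists j, (rosen_lambda q).
rewrite mulr1z mul1r -(subnSK jm); split=> //; first exact: ltnW.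
by apply: al; apply: leq_subr.
Qed.

Lemma alpha_Theta_ge {R : realType} (m q n : nat) :
  hecke_orbits m (rosen_lambda q : R) ->
  1 / 2 - (rosen_lambda q / 2) ^+ 2 ^+ n
    <= rosen_Theta q (- alpha (rosen_lambda q : R) m) n.
Proof.
move=> H; have [/andP[l1 l2] _ am _ al] := H.
have [d0 ->] := rosen_ThetaE n H (alpha_interval H (leqnn m)) (alpha_irrational H).
have [j [jm tE vle gap]] := alpha_orbit_v n H.
move: d0; rewrite tE; set v := rosen_v _ _ _ in vle gap *.
set w := alpha _ (m - j) in vle gap *; set z := _ ^+ n in gap *.
have aj := alpha_gt0 H jm; rewrite normrN gtr0_norm // => d0.
have w0 : 0 < w := alpha_gt0 H (leq_subr j m).
(* Equivalent to [a / (1 - a w) >= 1 / 2] for the limit [w] of [v], with equality at [j = 0]. *)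
have key : 1 <= alpha (rosen_lambda q) j * (2 + w).
  rewrite {d0 tE vle gap} /w in w0 *; case: j jm aj w0 => [|j] jm aj w0.
    rewrite subn0 am.
    have -> : 2 + (rosen_lambda q - 1) = rosen_lambda q + 1 :> R by ring.
    by rewrite mulVf // gt_eqF //; lra.
  have aj0 := alpha_gt0 H (ltnW jm).
  have e1 : alpha (rosen_lambda q) j.+1 * (rosen_lambda q - alpha (rosen_lambda q) j) = 1 :> R.
    by rewrite mulVf // gt_eqF // subr_gt0 al // ltnW.
  by rewrite -[X in X <= _]e1; apply: ler_wpM2l; lra.
move: aj d0 key; set a := alpha _ j => aj d0 key.
have z0 : 0 <= z by lra.
rewrite ler_pdivlMr //.
(* Replacing [w] by [v] in [key] costs at most [a z]. *)
have le1 : 1 + - a * v <= a * (2 + z).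
  have : 0 <= a * (z - (w - v)) by rewrite mulr_ge0 //; lra.
  lra.
have [e0|e0] := leP 0 (1 / 2 - z); last first.
  by apply: (@le_trans _ _ 0); [rewrite mulr_le0_ge0 // ltW|apply: ltW].
(* It remains that [(1/2 - z) (2 + z) = 1 - 3 z / 2 - z^2 <= 1]. *)
apply: (le_trans (ler_wpM2l e0 le1)).
rewrite mulrCA -{2}(mulr1 a) ler_pM2l //.
have : 0 <= z * z by rewrite mulr_ge0.
lra.
Qed.

(** * From unbounded index sets to the theorem *)

Lemma infinite_nat_unbounded (A : set nat) :
  (forall N, exists n, (N <= n)%N /\ A n) -> infinite_set A.
Proof.
move=> unb /finite_seqP[s As]; have [n [ns]] := unb (\max_(i <- s) i).+1.
rewrite As /= => sn; move: ns; rewrite ltnNge => /negP; apply.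
exact: (@leq_bigmax_seq nat s xpredT id n sn).
Qed.

Theorem theorem13 (R : realType) (p q : nat) (hp : (2 <= p)%N)
    (hq : q = (2 * p)%N) :
  (forall x : R, rosen_interval q x -> Gq_irrational q x ->
     infinite_set [set n : nat | rosen_Theta q x n <= 1 / 2])
  /\
  (forall c : R, c < 1 / 2 ->
     ~ (forall x : R, rosen_interval q x -> Gq_irrational q x ->
          infinite_set [set n : nat | rosen_Theta q x n <= c])).
Proof.
case: p hp hq => [|[|m]] // _ ->; have H := @hecke_orbits_lambda R m.
split=> [x I irr|c c12 inf].
  by apply: infinite_nat_unbounded => N; apply: (rosen_Theta_le_half _ H).
apply: (inf _ (alpha_interval H (leqnn m)) (alpha_irrational H)).
have [/andP[l1 l2] _ _ _ _] := H.
have z1 : 0 <= (rosen_lambda (2 * m.+2) / 2 : R) ^+ 2 < 1.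
  by rewrite exprn_ge0 ?expr_lt1 //; lra.
have e0 : 0 < 1 / 2 - c by lra.
have [N zN] := expr_eventually_lt z1 e0.
(* For [n >= N] the lower bound on [Theta_n] exceeds [c], so only indices below [N] qualify. *)
apply: (sub_finite_set (B := `I_N)) (finite_II N) => n /= h.
rewrite ltnNge; apply/negP => /zN; have := alpha_Theta_ge n H; lra.
Qed.
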